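(* Let $n\ge 3$ and let $W_n$ be the wheel on $n+1$ vertices. Then $rc^\ell(W_n)=1$ if $n=3$; $rc^\ell(W_n)=2$ if $n\in\{4,5,6\}$; and $rc^\ell(W_n)=3$ if $n\ge 7$.
   Context: The wheel $W_n$ ($n\ge 3$) is obtained from the cycle $C_n$ by adding a new vertex adjacent to all vertices of the cycle. An edge-coloured path is rainbow if all its edges have distinct colours. An (not necessarily proper) edge-colouring of a connected graph is rainbow connected if any two vertices are joined by a rainbow path. An $r$-edge-list assignment of $G$ assigns to each edge $e$ a set $L(e)\subset\mathbb N$ with $|L(e)|\ge r$; an $L$-edge-colouring is an edge-colouring $c$ with $c(e)\in L(e)$ for all $e$. $rc^\ell(G)$ is the minimum integer $r$ such that for every $r$-edge-list assignment $L$ of $G$ there exists a rainbow connected $L$-edge-colouring of $G$. *)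

(* Defs.v *)
From mathcomp Require Import all_boot.
From mathcomp Require Import classical_sets cardinality.

Set Implicit Arguments.
Unset Strict Implicit.
Unset Printing Implicit Defensive.

Local Open Scope set_scope.
Local Open Scope card_scope.

Record sgraph := SGraph {
  vertex :> finType;
  adj : rel vertex;
  adj_sym : symmetric adj;
  adj_irrefl : irreflexive adj }.
Arguments adj {s}.

Definition edges (G : sgraph) : {set {set G}} :=
  [set [set x; y]%SET | x in G, y in G & adj x y]%SET.

(* The cycle C_n on 'I_n; [i != j] only matters for n < 3, where it keeps the
   relation irreflexive. *)
Definition cycle_adj (n : nat) : rel 'I_n :=
  fun i j => (i != j) && ((j == ordS i) || (i == ordS j)).

Lemma cycle_adj_sym n : symmetric (@cycle_adj n).
Proof. by move=> i j; rewrite /cycle_adj eq_sym orbC. Qed.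

Lemma cycle_adj_irrefl n : irreflexive (@cycle_adj n).
Proof. by move=> i; rewrite /cycle_adj eqxx. Qed.

Definition cycle_graph (n : nat) : sgraph :=
  SGraph (@cycle_adj_sym n) (@cycle_adj_irrefl n).

(* [None] is the new vertex, joined to every vertex of [G]. *)
Definition cone_adj (G : sgraph) : rel (option G) :=
  fun u v => match u, v with
             | Some x, Some y => adj x y
             | None, None => false
             | _, _ => true
             end.

Lemma cone_adj_sym (G : sgraph) : symmetric (@cone_adj G).
Proof. by move=> [x|] [y|] //=; apply: adj_sym. Qed.

Lemma cone_adj_irrefl (G : sgraph) : irreflexive (@cone_adj G).
Proof. by move=> [x|] //=; apply: adj_irrefl. Qed.

Definition cone (G : sgraph) : sgraph :=
  SGraph (@cone_adj_sym G) (@cone_adj_irrefl G).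

Definition wheel (n : nat) : sgraph := cone (cycle_graph n).

(* List assignments and colourings are total on {set G}; only their values on
   [edges G] are ever constrained or used. *)
Definition edge_list_assignment (G : sgraph) (r : nat)
    (L : {set G} -> set nat) : Prop :=
  forall e : {set G}, e \in edges G -> `I_r #<= L e.

Definition list_edge_colouring (G : sgraph) (L : {set G} -> set nat)
    (c : {set G} -> nat) : Prop :=
  forall e : {set G}, e \in edges G -> L e (c e).

Definition path_edges (G : sgraph) (x : G) (p : seq G) : seq {set G} :=
  pairmap (fun u v => [set u; v]%SET) x p.

(* [x :: p] is a path of [G] from [x] to [y] with distinctly coloured edges. *)
Definition rainbow_path (G : sgraph) (c : {set G} -> nat) (x y : G)
    (p : seq G) : Prop :=
  [/\ path adj x p, uniq (x :: p), last x p = y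
    & uniq (map c (path_edges x p))].

Definition rainbow_connected (G : sgraph) (c : {set G} -> nat) : Prop :=
  forall x y : G, exists p : seq G, rainbow_path c x y p.

Definition list_rainbow_connectable (G : sgraph) (r : nat) : Prop :=
  forall L : {set G} -> set nat, edge_list_assignment r L ->
    exists c : {set G} -> nat, list_edge_colouring L c /\ rainbow_connected c.

(* rc^l(G) = r *)
Definition list_rainbow_connection_number (G : sgraph) (r : nat) : Prop :=
  list_rainbow_connectable G r /\
  forall s : nat, list_rainbow_connectable G s -> r <= s.

(* Main.v *)
(* Lower bounds: if all lists are {0, .., k - 1} then rainbow paths have length
   at most k.  For n >= 7 and k = 2, vertices at distance >= 3 on the cycle can
   only be joined through the hub, so their spokes differ; as 0, .., 6 lie on
   the cycle and only two colours occur, the spokes 3, 4, 5, 6 get the same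
   colour, although 3 and 6 are at distance 3.
   Upper bound 3: colour the spokes greedily so that cyclically consecutive ones
   differ, and each rim edge differently from the two spokes it meets.  Two
   vertices i, j with equally coloured spokes are joined by i, hub, j + 1, j.
   Upper bound 2 for n <= 6: colour the rim greedily so that consecutive edges
   differ, except perhaps around vertex 0; this joins i to i + 2.  The other
   non-adjacent pairs i < j form a subgraph of the path 3-0-4-1-5-2, along which
   the spokes are coloured greedily. *)
Require Import Defs.
From mathcomp Require Import all_boot.
From mathcomp Require Import boolp classical_sets functions cardinality.
From mathcomp Require Import zify.

Set Implicit Arguments.
Unset Strict Implicit.
Unset Printing Implicit Defensive.

(** * Greedy choice from lists *)

(** Pigeonhole: an injection of [I_r] into [A] has [r] distinct values, too many to lie all in
    [s]. *)
Lemma card_le_II_notin (r : nat) (A : set nat) (s : seq nat) :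
  (`I_r #<= A)%card -> size s < r -> exists2 x, A x & x \notin s.
Proof.
move=> /pcard_leP[f] lt_sr; apply: contrapT => noA.
suff: size (map f (iota 0 r)) <= size s.
  by rewrite size_map size_iota leqNgt lt_sr.
apply: uniq_leq_size => [|x /mapP[i]].
  rewrite map_inj_in_uniq ?iota_uniq // => i j.
  rewrite !mem_iota !add0n => lt_ir lt_jr; apply: inj; exact/mem_set.
rewrite mem_iota => lt_ir ->; apply: contrapT => /negP fi.
by apply: noA; exists (f i) => //; apply: funS.
Qed.

(** Here [s] is the list of forbidden colours; fixing one choice function [g] lets greedy colourings
    be written as plain recursions. *)
Lemma list_choice (I : Type) (r : nat) (A : I -> set nat) :
  (forall i, (`I_r #<= A i)%card) ->
  exists g : I -> seq nat -> nat, forall i s, size s < r ->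
    A i (g i s) /\ g i s \notin s.
Proof.
move=> Ar.
have [z|g gP] := @choice (I * seq nat) nat
    (fun z x => size z.2 < r -> A z.1 x /\ x \notin z.2).
  have [lt_zr|_] := ltnP (size z.2) r; last by exists 0.
  by have [x Ax xz] := card_le_II_notin (Ar z.1) lt_zr; exists x.
by exists (fun i s => g (i, s)) => i s; apply: (gP (i, s)).
Qed.

(** * Rainbow paths with at most two edges *)

Section Connection.
Variables (G : sgraph) (c : {set G} -> nat).

Lemma rainbow_path_refl (x : G) : rainbow_path c x x [::].
Proof. by []. Qed.

Lemma rainbow_path_adj (x y : G) : adj x y -> rainbow_path c x y [:: y].
Proof.
move=> xy; split; rewrite //= ?xy // inE andbT.
by apply: contraTneq xy => ->; rewrite adj_irrefl.
Qed.

Lemma rainbow_path2 (x z y : G) :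
  adj x z -> adj z y -> x != y -> c [set x; z]%SET != c [set z; y]%SET ->
  rainbow_path c x y [:: z; y].
Proof.
move=> xz zy xy cxy; split; rewrite //= ?xz ?zy // !inE ?andbT //.
rewrite negb_or xy andbT; apply/andP; split.
  by apply: contraTneq xz => ->; rewrite adj_irrefl.
by apply: contraTneq zy => ->; rewrite adj_irrefl.
Qed.

Lemma rainbow_path2_sym (x z y : G) :
  rainbow_path c x y [:: z; y] -> rainbow_path c y x [:: z; x].
Proof.
case; rewrite /= !andbT !inE negb_or.
move=> /andP[xz zy] /andP[/andP[_ nxy] _] _ ce.
apply: rainbow_path2; first by rewrite adj_sym.
- by rewrite adj_sym.
- by rewrite eq_sym.
- by rewrite [[set y; z]%SET]finset.setUC [[set z; x]%SET]finset.setUC eq_sym.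
Qed.

Lemma rainbow_path_size2 (x y : G) (p : seq G) :
  rainbow_path c x y p -> size p <= 2 ->
  [\/ x = y, adj x y
    | exists z, [/\ adj x z, adj z y & c [set x; z]%SET != c [set z; y]%SET]].
Proof.
case: p => [|z [|y' [|//]]] [] /=; first by move=> _ _ ->; constructor 1.
  by rewrite andbT => xz _ <-; constructor 2.
case/and3P=> xz zy _ _ <-; rewrite !inE !andbT => cxy _.
by constructor 3; exists z.
Qed.

End Connection.

(** * Constant lists, the source of the lower bounds *)

Lemma edges_adj (G : sgraph) (x y : G) : adj x y -> [set x; y]%SET \in edges G.
Proof. by move=> xy; apply/imset2P; exists x y; rewrite ?inE. Qed.

Lemma path_edges_sub (G : sgraph) (x : G) (p : seq G) :
  path adj x p -> {subset path_edges x p <= edges G}.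
Proof.
elim: p x => [|y p IHp] x //= /andP[xy yp] e.
by rewrite inE => /predU1P[->|/(IHp _ yp)//]; apply: edges_adj.
Qed.

(** Give every edge the list [I_k]: the colours along a rainbow path are distinct and below [k],
    which bounds its length. *)
Lemma connectable_short_rainbow (G : sgraph) (s k : nat) :
  list_rainbow_connectable G s -> s <= k ->
  exists2 c : {set G} -> nat, (forall e, e \in edges G -> c e < k)
    & forall x y : G, exists2 p, rainbow_path c x y p & size p <= k.
Proof.
move=> conn le_sk.
have [|c [Lc rc]] := conn (fun=> `I_k); first by move=> e _; rewrite card_le_II.
exists c => // x y; have [p rp] := rc x y; exists p => //.
case: rp => xp _ _ /uniq_leq_size le_c.
rewrite -(size_iota 0 k) -[size p](size_pairmap (fun u v => [set u; v]%SET) x).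
rewrite -(size_map c); apply: le_c => _ /mapP[e /(path_edges_sub xp) eE ->].
by rewrite mem_iota; apply: Lc.
Qed.

(** * Edges, colourings and paths of the wheel *)

Section Wheel.
Variable n : nat.
Hypothesis n_ge3 : 3 <= n.

Local Notation W := (wheel n).

Definition spoke (i : 'I_n) : {set W} := [set None; Some i]%SET.
Definition rim (i : 'I_n) : {set W} := [set Some i; Some (ordS i)]%SET.

Lemma val_ordS_small (i : 'I_n) : i.+1 < n -> ordS i = i.+1 :> nat.
Proof. by move=> lt_in; rewrite /= modn_small. Qed.

Lemma ordS_neq (i : 'I_n) : i != ordS i.
Proof.
apply/eqP => /(congr1 val) /=; have := ltn_ord i.
rewrite leq_eqVlt => /predU1P[def_n|lt_in]; last by rewrite modn_small //; lia.
by rewrite def_n modnn; lia.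
Qed.

Lemma ordS_ordS_neq (i : 'I_n) : ordS (ordS i) != i.
Proof.
apply/eqP => /(congr1 val) /=; rewrite -[(_ %% n).+1]addn1 modnDml addn1.
have lt_i := ltn_ord i; have [lt_in|le_ni] := ltnP i.+2 n.
  by rewrite modn_small //; lia.
by rewrite -(subnK le_ni) modnDr modn_small; lia.
Qed.

Lemma adj_rim (i : 'I_n) : adj (Some i : W) (Some (ordS i)).
Proof. by rewrite /= /cycle_adj ordS_neq eqxx. Qed.

Lemma adj_rimV (i : 'I_n) : adj (Some (ordS i) : W) (Some i).
Proof. by rewrite adj_sym adj_rim. Qed.

(** Trades the modular successor for linear arithmetic, with the wrap-around pair split off, so that
    [lia] can decide adjacency. *)
Lemma adj_wheelE (i j : 'I_n) : adj (Some i : W) (Some j) =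
  [|| j == i.+1 :> nat, i == j.+1 :> nat,
      (i == 0 :> nat) && (j.+1 == n) | (j == 0 :> nat) && (i.+1 == n)].
Proof.
have ordSE (k l : 'I_n) :
    (k == ordS l) = (k == l.+1 :> nat) || (k == 0 :> nat) && (l.+1 == n).
  have lt_k := ltn_ord k; rewrite -val_eqE /=.
  have := ltn_ord l; rewrite leq_eqVlt => /predU1P[eq_ln|lt_ln].
    by rewrite eq_ln modnn; lia.
  by rewrite modn_small //; lia.
by rewrite /= /cycle_adj !ordSE -val_eqE /=; lia.
Qed.

Lemma edges_wheelP (e : {set W}) :
  reflect ((exists i, e = spoke i) \/ (exists i, e = rim i)) (e \in edges W).
Proof.
apply: (iffP idP); last first.
  by case=> -[i ->]; apply: edges_adj => //; apply: adj_rim.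
case/imset2P => -[x|] [y|] _; rewrite inE //=; last 2 first.
- by move=> _ ->; left; exists x; rewrite finset.setUC.
- by move=> _ ->; left; exists y.
by case/andP=> _ /orP[]/eqP-> ->; right;
  [exists x | exists y; rewrite finset.setUC].
Qed.

Lemma spoke_inj : injective spoke.
Proof.
move=> i j /setP/(_ (Some i)); rewrite !inE eqxx /= => /esym/eqP[].
by [].
Qed.

(** Two indices for the same edge would be each other's successors, which [ordS_ordS_neq]
    forbids. *)
Lemma rim_inj : injective rim.
Proof.
move=> i j eq_ij; have /setP/(_ (Some i)) := eq_ij; rewrite !inE eqxx /=.
case/esym/orP => /eqP[] // def_i; have /setP/(_ (Some (ordS i))) := eq_ij.
rewrite !inE eqxx orbT => /esym/orP[]/eqP/(@Some_inj _ _ _) def_j.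
  by have := ordS_ordS_neq j; rewrite -def_i def_j eqxx.
by have := ordS_neq i; rewrite def_j -def_i eqxx.
Qed.

Lemma rim_neq_spoke (i j : 'I_n) : rim i != spoke j.
Proof. by apply/eqP => /setP/(_ None); rewrite !inE. Qed.

(** Spokes and rim edges are pairwise distinct sets, so their colours can be prescribed
    independently. *)
Lemma wheel_colouring (L : {set W} -> set nat) (s r : 'I_n -> nat) :
  (forall i, L (spoke i) (s i)) -> (forall i, L (rim i) (r i)) ->
  exists c, [/\ list_edge_colouring L c, forall i, c (spoke i) = s i
    & forall i, c (rim i) = r i].
Proof.
move=> Ls Lr.
pose c e := if [pick i | e == spoke i] is Some i then s i
            else if [pick i | e == rim i] is Some i then r i else 0.
have cs i : c (spoke i) = s i.
  rewrite /c; case: pickP => [j /eqP/spoke_inj-> //|/(_ i)].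
  by rewrite eqxx.
have cr i : c (rim i) = r i.
  rewrite /c; case: pickP => [j|_].
    by rewrite (negPf (rim_neq_spoke i j)).
  by case: pickP => [j /eqP/rim_inj-> //|/(_ i)]; rewrite eqxx.
exists c; split=> // e /edges_wheelP[][i ->]; [rewrite cs | rewrite cr]; auto.
Qed.

Lemma rainbow_path_hub c (i j : 'I_n) : c (spoke i) != c (spoke j) ->
  rainbow_path c (Some i : W) (Some j) [:: None; Some j].
Proof.
move=> cij; apply: rainbow_path2 => //; last by rewrite finset.setUC.
by apply: contraNneq cij => -[->].
Qed.

Lemma rainbow_path_rim2 c (i : 'I_n) : c (rim i) != c (rim (ordS i)) ->
  rainbow_path c (Some i : W) (Some (ordS (ordS i)))
    [:: Some (ordS i); Some (ordS (ordS i))].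
Proof.
move=> cij; apply: rainbow_path2; rewrite ?adj_rim //.
by apply: contraNneq (ordS_ordS_neq i) => -[<-].
Qed.

Lemma rainbow_path_hub_rim c (i j : 'I_n) : ~~ adj (Some i : W) (Some j) ->
  i != j -> uniq [:: c (spoke i); c (spoke (ordS j)); c (rim j)] ->
  rainbow_path c (Some i : W) (Some j) [:: None; Some (ordS j); Some j].
Proof.
move=> nadj ne_ij uc; split=> //.
- by have /= -> := adj_rimV j.
- rewrite /= !inE !andbT /= negb_or; apply/andP; split; last first.
    by rewrite eq_sym; apply: contraNneq (ordS_neq j) => -[<-].
  apply/andP; split; last by apply: contraNneq ne_ij => -[->].
  (* If [i] were [ordS j], it would be adjacent to [j]. *)
  by apply: contraNneq nadj => ->; apply: adj_rimV.
rewrite /path_edges /= [[set Some i; None]%SET]finset.setUC.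
by rewrite [[set Some (ordS j); Some j]%SET]finset.setUC.
Qed.

Lemma wheel_rainbow_connected (c : {set W} -> nat) :
  (forall i j : 'I_n, i != j -> ~~ adj (Some i : W) (Some j) ->
     exists p, rainbow_path c (Some i : W) (Some j) p) ->
  rainbow_connected c.
Proof.
move=> H x y; have [-> | ne_xy] := eqVneq x y.
  by exists [::]; apply: rainbow_path_refl.
have [xy|nxy] := boolP (adj x y); first by eexists; apply: rainbow_path_adj xy.
case: x y nxy ne_xy => [i|] [j|] // nij ne_ij; apply: H nij.
by apply: contraNneq ne_ij => ->.
Qed.

End Wheel.

(** * Upper bounds *)

Lemma wheel_connectable3 (n : nat) :
  3 <= n -> list_rainbow_connectable (wheel n) 3.
Proof.
case: n => // n n_ge3 L L3.
have [i|g gP] := @list_choice 'I_n.+1 3 (fun i => L (spoke i)).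
  by apply/L3/edges_wheelP => //; left; exists i.
have [i|h hP] := @list_choice 'I_n.+1 3 (fun i => L (rim i)).
  by apply/L3/edges_wheelP => //; right; exists i.
pose t0 := g (inord 0) [::].
(* Avoiding [t0] at every step, and not just the previous colour, settles the pair formed by the
   last spoke and spoke 0. *)
pose t := fix t k := if k is k'.+1 then g (inord k) [:: t k'; t0] else t0.
have tL k : L (spoke (inord k)) (t k).
  case: k => [|k]; first by have [] := gP (inord 0) [::].
  by have [] := gP (inord k.+1) [:: t k; t0].
have tS k : (t k.+1 != t k) && (t k.+1 != t 0).
  by have [] := gP (inord k.+1) [:: t k; t0]; rewrite // !inE negb_or.
pose s (i : 'I_n.+1) := t i.
pose r i := h i [:: s i; s (ordS i)].
have rP i : L (rim i) (r i) /\ r i \notin [:: s i; s (ordS i)] by apply: hP.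
have sS i : s (ordS i) != s i.
  rewrite /s; have := ltn_ord i; rewrite leq_eqVlt => /predU1P[eq_in|lt_in].
    rewrite /= eq_in modnn.
    case: (nat_of_ord i) eq_in => [|k] eq_kn; first by lia.
    by have /andP[_] := tS k; rewrite eq_sym.
  by rewrite val_ordS_small //; have /andP[] := tS i.
have [i|i|c [Lc cs cr]] := @wheel_colouring n.+1 n_ge3 L s r.
- by have := tL i; rewrite inord_val.
- by have [] := rP i.
exists c; split=> //; apply: wheel_rainbow_connected => // i j ne_ij nadj.
have [eq_s|ne_s] := eqVneq (s i) (s j); last first.
  by eexists; apply: rainbow_path_hub; rewrite !cs.
eexists; apply: rainbow_path_hub_rim => //; rewrite !cs cr /=.
have [_] := rP j; rewrite !inE !negb_or eq_s ![_ == r j]eq_sym => /andP[-> ->].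
by rewrite eq_sym sS.
Qed.

Lemma wheel_connectable2 (n : nat) :
  3 <= n <= 6 -> list_rainbow_connectable (wheel n) 2.
Proof.
case: n => // n /andP[n_ge3 n_le6] L L2.
have [i|g gP] := @list_choice 'I_n.+1 2 (fun i => L (spoke i)).
  by apply/L2/edges_wheelP => //; left; exists i.
have [i|h hP] := @list_choice 'I_n.+1 2 (fun i => L (rim i)).
  by apply/L2/edges_wheelP => //; right; exists i.
(* Only the last rim edge and edge 0 may clash. They meet at vertex 0, which is never the middle of
   a path from [i] to [i + 2] with [i + 2 <= n]. *)
pose t := fix t k :=
  if k is k'.+1 then h (inord k) [:: t k'] else h (inord 0) [::].
have tL k : L (rim (inord k)) (t k).
  case: k => [|k]; first by have [] := hP (inord 0) [::].
  by have [] := hP (inord k.+1) [:: t k].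
have tS k : t k.+1 != t k.
  by have [] := hP (inord k.+1) [:: t k]; rewrite // inE.
(* The path 3-0-4-1-5-2 is coloured outwards from 1. For an index above [n], [inord] falls back to
   0; the resulting colour is avoided by others but never put on a spoke. *)
pose s1 := g (inord 1) [::].
pose s4 := g (inord 4) [:: s1].
pose s0 := g (inord 0) [:: s4].
pose s3 := g (inord 3) [:: s0].
pose s5 := g (inord 5) [:: s1].
pose s2 := g (inord 2) [:: s5].
pose s (i : 'I_n.+1) := nth 0 [:: s0; s1; s2; s3; s4; s5] i.
have gL i x : L (spoke i) (g i [:: x]) by have [] := gP i [:: x].
have gN i x : g i [:: x] != x by have [] := gP i [:: x]; rewrite // inE.
have sL i : L (spoke i) (s i).
  rewrite -{1}[i]inord_val /s; case: i => -[|[|[|[|[|[|i]]]]]] lt_i /=;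
    try exact: gL; last by have := lt_i; lia.
  by have [] := gP (inord 1) [::].
(* The pairs covered are 03, 04, 14, 15 and 25, exactly the edges of that path. The pair 05 occurs
   only on the six-cycle, where it is adjacent. *)
have sN (i j : 'I_n.+1) : i.+2 < j ->
    ~~ ((i == 0 :> nat) && (j == 5 :> nat)) -> s i != s j.
  move=> lt_ij; have := leq_trans (ltn_ord j) n_le6; rewrite /s.
  case: i lt_ij => i _ /=; case: j => j _ /=.
  case: j => [|[|[|[|[|[|j]]]]]] //; case: i => [|[|[|i]]] //= _ _ _;
    by [exact: gN | rewrite eq_sym; exact: gN].
have [i|i|c [Lc cs cr]] := @wheel_colouring n.+1 n_ge3 L s t.
- exact: sL.
- by have := tL i; rewrite inord_val.
exists c; split=> //; apply: wheel_rainbow_connected => // i j ne_ij nadj.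
suff [z rp]: exists z,
    rainbow_path c (Some i : wheel _) (Some j) [:: z; Some j].
  by eexists; exact: rp.
wlog lt_ij : i j ne_ij nadj / i < j.
  move=> H; have [lt_ij|lt_ji|/val_inj eq_ij] := ltngtP i j; first exact: H.
    have [||//|z /rainbow_path2_sym rp] := H j i; first by rewrite eq_sym.
      by rewrite adj_sym.
    by exists z.
  by rewrite eq_ij eqxx in ne_ij.
have lt_j := ltn_ord j; move: nadj; rewrite adj_wheelE // => nadj.
(* A gap of two is crossed along the rim, a larger one through the hub. *)
have [eq_j|ne_j] := eqVneq (nat_of_ord j) i.+2; last first.
  exists None; apply: rainbow_path_hub.
  by rewrite !cs; apply: sN; lia.
have Si : ordS i = i.+1 :> nat by rewrite val_ordS_small //; lia.
have -> : j = ordS (ordS i).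
  by apply: val_inj; rewrite [RHS]val_ordS_small Si //; lia.
exists (Some (ordS i)); apply: rainbow_path_rim2 => //.
by rewrite !cr Si eq_sym tS.
Qed.

(** * Lower bounds *)

Lemma wheel_connectable_ge3 (n s : nat) : 7 <= n ->
  list_rainbow_connectable (wheel n) s -> 3 <= s.
Proof.
case: n => // n n_ge7 conn; rewrite ltnNge; apply/negP => le_s2.
have [c c2 rc] := connectable_short_rainbow conn le_s2.
pose f k := c (spoke (inord k : 'I_n.+1)).
have f2 k : f k < 2 by apply/c2/edges_wheelP; [lia | left; exists (inord k)].
(* Gaps of 3 or 4 among 0, .., 6 leave at least 3 steps the other way round, so the only common
   neighbour is the hub. *)
have fN i j : i + 3 <= j <= i + 4 -> j <= 6 -> f i != f j.
  move=> /andP[le_ij le_ji] le_j6.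
  have vi : (inord i : 'I_n.+1) = i :> nat by rewrite inordK //; lia.
  have vj : (inord j : 'I_n.+1) = j :> nat by rewrite inordK //; lia.
  have [p rp le_p2] := rc (Some (inord i)) (Some (inord j)).
  have [[/(congr1 val)/=]||[[x|] []]] := rainbow_path_size2 rp le_p2.
  - by rewrite !inordK; lia.
  - by rewrite adj_wheelE; lia.
  - by have := ltn_ord x; rewrite !adj_wheelE; lia.
  by rewrite finset.setUC.
(* Both colours differ from [f i], and only two colours exist. *)
have E i : i <= 2 -> f (i + 3) = f (i + 4).
  move=> le_i2; have := fN i (i + 3); have := fN i (i + 4).
  by have := f2 i; have := f2 (i + 3); have := f2 (i + 4); lia.
have := fN 3 6 isT isT; have := E 0 isT; have := E 1 isT; have := E 2 isT.
by rewrite !add0n => -> -> ->; rewrite eqxx.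
Qed.

Lemma wheel_connectable_ge2 (n s : nat) : 4 <= n ->
  list_rainbow_connectable (wheel n) s -> 2 <= s.
Proof.
case: n => // n n_ge4 conn; rewrite ltnNge; apply/negP => le_s1.
have [c c1 rc] := connectable_short_rainbow conn le_s1.
(* Vertices 0 and 2 are not adjacent on a cycle of length at least 4, and a two-edge path would
   repeat the only colour 0. *)
have [p rp le_p1] := rc (Some (inord 0)) (Some (inord 2)).
have [[/(congr1 val)/=]||[z [/edges_adj/c1 + /edges_adj/c1]]] :=
  rainbow_path_size2 rp (leqW le_p1).
- by rewrite !inordK; lia.
- by rewrite adj_wheelE ?inordK; lia.
by rewrite !ltnS !leqn0 => /eqP-> /eqP->.
Qed.

(** With no colours at all, only the empty path is short enough, and it joins a vertex to itself. *)
Lemma connectable_gt0 (G : sgraph) (x y : G) (s : nat) : x != y ->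
  list_rainbow_connectable G s -> 0 < s.
Proof.
move=> ne_xy conn; rewrite lt0n; apply/eqP => s0.
have [c _ rc] := connectable_short_rainbow conn (eq_leq s0).
by have [[|//] [_ _ /= eq_xy _] _] := rc x y; rewrite eq_xy eqxx in ne_xy.
Qed.

(** * The complete case and the conclusion *)

(** [wheel 3] is the complete graph on four vertices, so any colouring from the lists will do. *)
Lemma wheel3_connectable1 : list_rainbow_connectable (wheel 3) 1.
Proof.
move=> L L1.
have [i|g gP] := @list_choice 'I_3 1 (fun i => L (spoke i)).
  by apply/L1/edges_wheelP => //; left; exists i.
have [i|h hP] := @list_choice 'I_3 1 (fun i => L (rim i)).
  by apply/L1/edges_wheelP => //; right; exists i.
have [i|i|c [Lc _ _]] :=
  @wheel_colouring 3 isT L (fun i => g i [::]) (fun i => h i [::]).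
- by have [] := gP i [::].
- by have [] := hP i [::].
exists c; split=> //; apply: wheel_rainbow_connected => // i j ne_ij.
rewrite adj_wheelE //; have := ltn_ord i; have := ltn_ord j.
by move: ne_ij; rewrite -val_eqE /=; lia.
Qed.

Theorem theorem3p7 (n : nat) (hn : 3 <= n) :
  [/\ n = 3 -> list_rainbow_connection_number (wheel n) 1,
      n \in [:: 4; 5; 6] -> list_rainbow_connection_number (wheel n) 2
    & 7 <= n -> list_rainbow_connection_number (wheel n) 3].
Proof.
split=> [->|n456|n_ge7].
- split=> [|s]; first exact: wheel3_connectable1.
  by apply: (@connectable_gt0 (wheel 3) None (Some ord0)).
- have n46 : 4 <= n <= 6 by move: n456; rewrite !inE; lia.
  split=> [|s]; first by apply: wheel_connectable2; lia.
  by apply: wheel_connectable_ge2; lia.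
- by split=> [|s]; [apply: wheel_connectable3 | apply: wheel_connectable_ge3].
Qed.
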